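(* Let $(S,\ell,\delta)$ be an automaton satisfying the productivity assumption. There is a unique map $[\![-]\!]:S\to D(\mathbb{N}^{\Sigma^*})$ such that for every $s\in S$: $[\![ s]\!]=\delta_{\{|\varepsilon|\}}$ if $\ell(s)=\mathsf{skip}$; $[\![ s]\!]=\delta_{\{||\}}$ if $\ell(s)=\mathsf{fail}$; $[\![ s]\!]=a\cdot[\![ t]\!]$ if $\ell(s)=a\in\Sigma$ and $\delta(s)=t$; $[\![ s]\!]=\sum_ir_i[\![ t_i]\!]$ if $\ell(s)=\oplus$ and $\delta(s)=\sum_i r_it_i$; and $[\![ s]\!]=\&\{|[\![ t]\!] : t\in m|\}$ if $\ell(s)=\&$ and $\delta(s)=m$. (That is, the semantic map on automata is well defined.)
   Context: $\Sigma$ is a finite alphabet, $\Sigma^*$ the finite strings, $\varepsilon$ the empty string. $\mathbb{N}^{\Sigma^*}$ is the set of functions $\alpha:\Sigma^*\to\mathbb{N}$ (multisets of strings with finite multiplicities), $+$ pointwise sum, $\{\!|\,|\!\}$ the empty multiset, $\{\!|\varepsilon|\!\}$ a singleton. $\alpha\equiv_n\beta$ iff $\alpha(x)=\beta(x)$ for all strings of length $\le n$; $\mathbb{N}^{\Sigma^*}$ carries the $\sigma$-algebra generated by the classes $[\alpha]_n$; $D(\mathbb{N}^{\Sigma^*})$ is its set of probability measures, $\delta_\alpha$ Dirac. For $x\in\Sigma^*$: $(x\cdot\alpha)(xy)=\alpha(y)$, $(x\cdot\alpha)(z)=0$ if $x$ is not a prefix of $z$; $x\cdot\mu=\mu\circ(x\cdot-)^{-1}$.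 For a finite multiset $m$ of measures, $\&m$ is the pushforward under summation of the product measure of its members (one factor per occurrence). An automaton is $(S,\ell,\delta)$ with $S$ finite and $\ell:S\to\{\&,\oplus,\mathsf{skip},\mathsf{fail}\}\cup\Sigma$; $\delta(s)$ is a finite probability distribution on $S$ if $\ell(s)=\oplus$, a finite multiset of states if $\ell(s)=\&$, a state if $\ell(s)\in\Sigma$, and absent if $\ell(s)\in\{\mathsf{skip},\mathsf{fail}\}$. Productivity assumption: every cycle in the transition graph contains a state labelled by a letter of $\Sigma$. *)

(* Defs.v *)
From mathcomp Require Import all_boot all_order all_algebra.
From mathcomp Require Import finmap multiset.
From mathcomp Require Import all_classical all_reals all_analysis.

Set Implicit Arguments.
Unset Strict Implicit.
Unset Printing Implicit Defensive.

Import Order.TTheory GRing.Theory Num.Theory.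
Import numFieldNormedType.Exports.

Local Open Scope classical_set_scope.
Local Open Scope ring_scope.

Section StringMultisets.
Variable Sigma : finType.

Definition eq_upto (n : nat) (alpha beta : seq Sigma -> nat) : Prop :=
  forall x : seq Sigma, (size x <= n)%N -> alpha x = beta x.

Definition eq_classes : set (set (seq Sigma -> nat)) :=
  [set C | exists alpha n, C = [set beta | eq_upto n alpha beta]].

Definition string_mset := g_sigma_algebraType eq_classes.

Definition sm_empty : string_mset := fun=> 0%N.

Definition sm_eps : string_mset := fun x => (x == [::] : nat).

Definition sm_sum n (alphas : n.-tuple string_mset) : string_mset :=
  fun x => (\sum_(i < n) tnth alphas i x)%N.

Definition sm_act (x : seq Sigma) (alpha : string_mset) : string_mset :=
  fun z => if prefix x z then alpha (drop (size x) z) else 0%N.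

End StringMultisets.

Section ProductMeasure.
Context d (T : measurableType d) (R : realType).

Fixpoint product_measure_seq (mus : seq (probability T R)) :
    set ((size mus).-tuple T) -> \bar R :=
  match mus return set ((size mus).-tuple T) -> \bar R with
  | [::] => dirac [tuple]
  | mu :: mus' =>
      pushforward (mu \x @product_measure_seq mus')%E
        (fun p : T * (size mus').-tuple T => [tuple of p.1 :: p.2])
  end.

End ProductMeasure.

Record fdist (R : realType) (S : finType) := FDist {
  fdist_fun :> S -> R;
  fdist_ge0 : forall t, 0 <= fdist_fun t;
  fdist_sum1 : \sum_t fdist_fun t = 1 }.

Section Operations.
Variables (R : realType) (Sigma : finType).

(* The operations on D(N^Sigma^* ) are written as functions on all sets of
   multisets; only their values on measurable sets are used. *)

Definition act_measure (x : seq Sigma)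
    (mu : probability (string_mset Sigma) R) :
    set (string_mset Sigma) -> \bar R :=
  pushforward mu (sm_act x).

(* A finite multiset of measures is given by an enumeration with repetitions;
   the order is irrelevant since the sum of multisets is commutative. *)
Definition par_measure (mus : seq (probability (string_mset Sigma) R)) :
    set (string_mset Sigma) -> \bar R :=
  pushforward (@product_measure_seq _ _ _ mus) (@sm_sum Sigma (size mus)).

Definition mix_measure (S : finType) (r : fdist R S)
    (mu : S -> probability (string_mset Sigma) R) :
    set (string_mset Sigma) -> \bar R :=
  fun B => (\sum_(t : S) (r t)%:E * mu t B)%E.

End Operations.

Inductive label (Sigma : Type) : Type :=
  | Par | Oplus | Skip | Fail | Letter of Sigma.
Arguments Par {Sigma}.
Arguments Oplus {Sigma}.
Arguments Skip {Sigma}.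
Arguments Fail {Sigma}.

Definition transition (R : realType) (Sigma S : finType) (l : label Sigma) : Type :=
  match l with
  | Par => multiset S
  | Oplus => fdist R S
  | Skip | Fail => unit
  | Letter _ => S
  end.

Record automaton (R : realType) (Sigma : finType) := Automaton {
  state :> finType;
  lab : state -> label Sigma;
  delta : forall s : state, transition R state (lab s) }.

Section Semantics.
Variables (R : realType) (Sigma : finType) (A : automaton R Sigma).

Definition is_letter (s : A) : bool :=
  if lab s is Letter _ then true else false.

Definition edge (s t : A) : bool :=
  match lab s as l return transition R A l -> bool with
  | Par => fun m => t \in m
  | Oplus => fun r => 0 < r t
  | Skip | Fail => fun _ => false
  | Letter _ => fun u => t == u
  end (delta s).

Definition productive : Prop :=
  forall c : seq A, c != [::] -> cycle edge c -> has is_letter c.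

Definition sem_rhs (sem : A -> probability (string_mset Sigma) R) (s : A) :
    set (string_mset Sigma) -> \bar R :=
  match lab s as l return transition R A l -> set (string_mset Sigma) -> \bar R with
  | Skip => fun _ => dirac (@sm_eps Sigma)
  | Fail => fun _ => dirac (@sm_empty Sigma)
  | Letter a => fun t => act_measure [:: a] (sem t)
  | Oplus => fun r => mix_measure r sem
  | Par => fun m => par_measure [seq sem t | t <- enum_mset m]
  end (delta s).

(* Equality of measures is equality on measurable sets: the library's measures
   are functions on all sets, with unconstrained values outside the
   sigma-algebra. *)
Definition is_semantics (sem : A -> probability (string_mset Sigma) R) : Prop :=
  forall s (B : set (string_mset Sigma)), measurable B ->
    sem s B = sem_rhs sem s B.

End Semantics.

(* Main.v *)
(** Two measures are compared level by level, on the cylinders of level [n],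
    i.e. the events that only depend on the multiplicities of the strings
    shorter than [n].  The right-hand side of the equations preserves agreement
    at level [n] and, at a letter state, gains one level.  By productivity the
    edges leaving non-letter states form an acyclic graph, so an induction along
    it turns this gain into a contraction: two solutions agree at every level,
    and the iterates from any starting point stabilise at every level.

    The limit of the iterates is obtained from its values on cylinders by
    Caratheodory extension.  Countable additivity is a Konig-type argument: if
    decreasing cylinders keep their mass, some branch of nested balls keeps its
    mass too, because each level has only countably many balls, and the limit
    of that branch lies in all the cylinders. *)

Require Import Defs.
From HB Require Import structures.
From mathcomp Require Import all_boot all_order all_algebra.
From mathcomp Require Import multiset.
From mathcomp Require Import all_classical all_reals all_analysis.

Set Implicit Arguments.
Unset Strict Implicit.
Unset Printing Implicit Defensive.

Import Order.TTheory GRing.Theory Num.Theory.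

Local Open Scope classical_set_scope.
Local Open Scope ring_scope.

(** * Constructing probability measures *)

Section MeasureProbability.
Context d (T : measurableType d) (R : realType).
Variables (mu : {measure set T -> \bar R}) (muT : mu setT = 1%E).

(* A global constant, since a [Let] would be unfolded at the end of the section
   and turn the instances below into instances for every measure. *)
Definition normalized_measure : set T -> \bar R := mu.

HB.instance Definition _ := Measure.on normalized_measure.
HB.instance Definition _ := Measure_isProbability.Build _ _ _ normalized_measure muT.

Lemma probability_of_measure :
  exists P : probability T R, P = mu :> (set T -> \bar R).
Proof. by exists normalized_measure. Qed.

End MeasureProbability.

Lemma pushforward_probability d d' (T : measurableType d) (T' : measurableType d')
    (R : realType) (P : probability T R) (f : T -> T') :
  measurable_fun [set: T] f ->
  exists Q : probability T' R, Q = pushforward P f :> (set T' -> \bar R).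
Proof.
move=> mf; pose X : {mfun T >-> T'} := HB.pack f (isMeasurableFun.Build _ _ _ _ f mf).
by exists (distribution P X).
Qed.

(** * Cylinders of finite level, for multisets and for tuples of multisets *)

Section Cylinders.
Variable Sigma : finType.
Local Notation M := (string_mset Sigma).
Implicit Types (alpha beta : M) (B : set M) (n : nat).

(* Strict variant of [eq_upto], for which level [0] carries no information. *)
Definition agree n alpha beta := forall x, (size x < n)%N -> alpha x = beta x.

Definition cyl_ball n alpha : set M := [set beta | agree n alpha beta].

Definition cylinder n B := forall alpha beta, agree n alpha beta -> B alpha -> B beta.

Lemma agree_sym n alpha beta : agree n alpha beta -> agree n beta alpha.
Proof. by move=> ab x xn; rewrite ab. Qed.

Lemma agree_trans n beta alpha gamma :
  agree n alpha beta -> agree n beta gamma -> agree n alpha gamma.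
Proof. by move=> ab bc x xn; rewrite ab// bc. Qed.

Lemma agree_le m n alpha beta : (m <= n)%N -> agree n alpha beta -> agree m alpha beta.
Proof. by move=> mn ab x xm; apply: ab; exact: leq_trans mn. Qed.

Lemma cylinder_le m n B : (m <= n)%N -> cylinder m B -> cylinder n B.
Proof. by move=> mn cB a b ab; apply: cB; exact: agree_le ab. Qed.

Lemma cylinder_ball n alpha : cylinder n (cyl_ball n alpha).
Proof. by move=> a b ab aa; exact: agree_trans ab. Qed.

Lemma cylinderC n B : cylinder n B -> cylinder n (~` B).
Proof. by move=> cB a b ab nBa Bb; apply: nBa; apply: cB Bb; exact: agree_sym. Qed.

Lemma cylinderU n B C : cylinder n B -> cylinder n C -> cylinder n (B `|` C).
Proof. by move=> cB cC a b ab [/cB|/cC]; [left|right]; eauto. Qed.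

Lemma cylinder_bigcup (I : Type) (P : set I) n (F : I -> set M) :
  (forall i, cylinder n (F i)) -> cylinder n (\bigcup_(i in P) F i).
Proof. by move=> cF a b ab [i Pi Fa]; exists i => //; exact: cF Fa. Qed.

Lemma cylinder0 B : cylinder 0 B -> B = set0 \/ B = setT.
Proof.
move=> cB; have [[a Ba]|nB] := pselect (B !=set0); last first.
  by left; apply/eqP/negP => /negP /set0P.
by right; apply/seteqP; split=> // b _; apply: cB Ba.
Qed.

(** Extension by zero of a table on the finitely many strings of length at most [n]. Such tables
    form a countable type, which is what makes the balls of a level countable. *)
Definition mset_rep n (t : {ffun n.-bseq Sigma -> nat}) : M :=
  fun x => oapp t 0%N (insub x).

Lemma agree_mset_rep n alpha :
  agree n alpha (mset_rep [ffun x : n.-bseq Sigma => alpha x]).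
Proof.
by move=> x xn; rewrite /mset_rep insubT ?(ltnW xn)//= => ?; rewrite ffunE.
Qed.

Lemma measurable_ball n alpha : measurable (cyl_ball n alpha).
Proof.
case: n => [|n]; last by apply: sub_sigma_algebra; exists alpha, n.
by rewrite (_ : cyl_ball 0 _ = setT)//; apply/seteqP; split.
Qed.

Lemma bigcup_ball n : \bigcup_t cyl_ball n (@mset_rep n t) = setT.
Proof.
apply/seteqP; split=> // a _; exists [ffun x => a (val x)] => //.
exact/agree_sym/agree_mset_rep.
Qed.

(* There are only countably many balls of a given level. *)
Lemma measurable_cylinder n B : cylinder n B -> measurable B.
Proof.
move=> cB; rewrite (_ : B = \bigcup_t (cyl_ball n (@mset_rep n t) `&`
    [set _ | B (mset_rep t)])).
  apply: countable_bigcupT_measurable => // t.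
  have [Bt|nBt] := pselect (B (mset_rep t)).
    rewrite (_ : [set _ | _] = setT) ?setIT; last by apply/seteqP; split.
    exact: measurable_ball.
  rewrite (_ : [set _ | _] = set0) ?setI0; last by apply/seteqP; split.
  exact: measurable0.
apply/seteqP; split=> [a Ba|a [t _ [ta Bt]]]; last exact: cB Bt.
exists [ffun x => a (val x)] => //; split; first exact/agree_sym/agree_mset_rep.
by apply: cB Ba; exact: agree_mset_rep.
Qed.

(** The generating class of [eq_upto n] is a ball of level [n.+1], so every generator is itself a
    cylinder. *)
Lemma measurable_fun_cylinder d (X : measurableType d) (f : X -> M) :
  (forall n B, cylinder n B -> measurable (f @^-1` B)) ->
  measurable_fun [set: X] f.
Proof.
move=> mf; apply: (@measurability _ _ X M setT f (@eq_classes Sigma)) => //.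
move=> _ [_ [a [n ->]] <-]; rewrite setTI; apply: (mf n.+1).
exact: (@cylinder_ball n.+1 a).
Qed.

Lemma agree_act n (a : Sigma) alpha beta :
  agree n alpha beta -> agree n.+1 (sm_act [:: a] alpha) (sm_act [:: a] beta).
Proof.
move=> ab [|b x]//= xn; rewrite /sm_act.
by case: ifP => //= _; rewrite drop0 ab.
Qed.

Lemma cylinder_act n (a : Sigma) B :
  cylinder n.+1 B -> cylinder n (sm_act [:: a] @^-1` B).
Proof. by move=> cB x y xy; apply: cB; exact: agree_act. Qed.

Lemma measurable_sm_act (a : Sigma) : measurable_fun [set: M] (sm_act [:: a]).
Proof.
apply: measurable_fun_cylinder => n B cB; apply: (@measurable_cylinder n).
by apply: cylinder_act; exact: cylinder_le cB.
Qed.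

(** Stated on plain sequences rather than tuples, so that one event [C] can be read on tuple types
    whose lengths are only propositionally equal. Beyond the end both sides take the same
    default. *)
Definition agree_seq n (s t : seq M) :=
  size s = size t /\
  forall i, agree n (nth (@sm_empty Sigma) s i) (nth (@sm_empty Sigma) t i).

Definition cylinder_seq n (C : set (seq M)) :=
  forall s t, agree_seq n s t -> C s -> C t.

(** As for a single multiset: the event is a countable union of boxes [E t], each a finite
    intersection of coordinatewise balls around representatives. *)
Lemma measurable_cylinder_seq n k (C : set (seq M)) : cylinder_seq n C ->
  measurable [set s : k.-tuple M | C s].
Proof.
move=> cC.
pose rep (t : {ffun 'I_k -> {ffun n.-bseq Sigma -> nat}}) : seq M :=
  [tuple mset_rep (t i) | i < k].
pose E (t : {ffun 'I_k -> {ffun n.-bseq Sigma -> nat}}) : set (k.-tuple M) :=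
  \bigcap_i [set s : k.-tuple M | cyl_ball n (mset_rep (t i)) (tnth s i)].
have repE t i (ik : (i < k)%N) :
    nth (@sm_empty Sigma) (rep t) i = mset_rep (t (Ordinal ik)).
  by rewrite /rep -[i]/(val (Ordinal ik)) -tnth_nth tnth_mktuple.
have EP t (s : k.-tuple M) : E t s <-> agree_seq n (rep t) s.
  split=> [H|[_ H] i _].
    split=> [|i]; first by rewrite !size_tuple.
    have [ik|ki] := ltnP i k; last by rewrite !nth_default ?size_tuple.
    rewrite repE; have := H (Ordinal ik) I.
    by rewrite /cyl_ball/= (tnth_nth (@sm_empty Sigma)).
  rewrite /cyl_ball/= (tnth_nth (@sm_empty Sigma)); have := H i.
  by rewrite repE (_ : Ordinal _ = i)//; exact: val_inj.
rewrite (_ : [set s : k.-tuple M | C s] =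
    \bigcup_t (E t `&` [set _ | C (rep t)])).
  apply: countable_bigcupT_measurable => // t.
  have [Ct|nCt] := pselect (C (rep t)); last first.
    rewrite (_ : [set _ | _] = set0) ?setI0; last by apply/seteqP; split.
    exact: measurable0.
  rewrite (_ : [set _ | _] = setT) ?setIT; last by apply/seteqP; split.
  apply: fin_bigcap_measurable => [|i _]; first exact: finite_finset.
  rewrite -[X in measurable X]setTI; apply: measurable_tnth => //.
  exact: measurable_ball.
apply/seteqP; split=> [s Cs|s [t _ [/EP ts Ct]]]; last exact: cC Ct.
pose t := [ffun i : 'I_k => [ffun x : n.-bseq Sigma => tnth s i x]].
have ts : agree_seq n (rep t) s.
  apply/EP => i _ /=.
  by rewrite /t ffunE /cyl_ball/=; exact/agree_sym/agree_mset_rep.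
exists t => //; split; first exact/EP.
apply: cC Cs; case: ts => ss H; split => // i; exact/agree_sym.
Qed.

Lemma cylinder_seq_cons n (C : set (seq M)) alpha : cylinder_seq n C ->
  cylinder_seq n [set s | C (alpha :: s)].
Proof.
move=> cC s t [st H]; apply: cC; split=> [|[|i]] //=; first by rewrite st.
Qed.

Lemma cylinder_seq_head n (C : set (seq M)) s : cylinder_seq n C ->
  cylinder n [set alpha | C (alpha :: s)].
Proof. by move=> cC a b ab; apply: cC; split=> // -[|i]. Qed.

Definition seq_sum (s : seq M) : M := fun x => (\sum_(alpha <- s) alpha x)%N.

Lemma sm_sumE k (s : k.-tuple M) : sm_sum s = seq_sum s.
Proof. by apply/funext => x; rewrite /sm_sum /seq_sum big_tuple. Qed.

Lemma cylinder_seq_sum n B : cylinder n B -> cylinder_seq n (seq_sum @^-1` B).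
Proof.
move=> cB s t [st H]; apply: cB => x xn; rewrite /seq_sum.
rewrite !(big_nth (@sm_empty Sigma)) st.
by apply: eq_bigr => i _; apply: H.
Qed.

Lemma measurable_sm_sum k : measurable_fun [set: k.-tuple M] (@sm_sum Sigma k).
Proof.
apply: measurable_fun_cylinder => n B cB.
rewrite (_ : _ @^-1` _ = [set s : k.-tuple M | (seq_sum @^-1` B) s]).
  by apply: (@measurable_cylinder_seq n); exact: cylinder_seq_sum.
by apply/seteqP; split=> s /=; rewrite sm_sumE.
Qed.

End Cylinders.

(* The same type, with the algebra of cylinders as its measurable sets. *)
Definition cylinder_algebra (Sigma : finType) := string_mset Sigma.

Section CylinderAlgebra.
Variable Sigma : finType.
Local Notation M := (string_mset Sigma).

Definition is_cylinder : set (set M) := [set B | exists n, cylinder n B].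

Lemma is_cylinder0 : is_cylinder set0. Proof. by exists 0%N. Qed.

Lemma is_cylinderU : setU_closed is_cylinder.
Proof.
move=> A B [m cA] [n cB]; exists (maxn m n); apply: cylinderU.
  exact: cylinder_le (leq_maxl _ _) cA.
exact: cylinder_le (leq_maxr _ _) cB.
Qed.

Lemma is_cylinderC : setC_closed is_cylinder.
Proof. by move=> A [n cA]; exists n; exact: cylinderC. Qed.

HB.instance Definition _ := Pointed.on (cylinder_algebra Sigma).
HB.instance Definition _ := @isAlgebraOfSets.Build default_measure_display
  (cylinder_algebra Sigma) is_cylinder is_cylinder0 is_cylinderU is_cylinderC.

End CylinderAlgebra.

(** * Limit of a sequence of probabilities that is stationary at each level *)

Section Limit.
Variables (R : realType) (Sigma : finType).
Local Notation M := (string_mset Sigma).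
Variables (mu : nat -> probability M R) (N : nat -> nat).
Hypothesis mu_stable : forall n k B, cylinder n B -> (N n <= k)%N ->
  mu k B = mu (N n) B.
Local Open Scope ereal_scope.

(* Any level of [B] gives the same value; off the cylinders the value is junk. *)
Definition limit_content (B : set (cylinder_algebra Sigma)) : \bar R :=
  mu (N (xget 0%N [set n | cylinder n B])) B.

Local Notation m := limit_content.

Lemma limit_contentE n k B : cylinder n B -> (N n <= k)%N -> m B = mu k B.
Proof.
move=> cB nk; rewrite /m; set l := xget _ _.
have cl : cylinder l B by rewrite /l; case: xgetP => [_ _ //|/(_ n)].
(* The chosen level [l] need not be comparable with [n]; both values are compared at an index beyond
   [N l] and [k]. *)
rewrite -(mu_stable cl (leq_maxl _ k)) (mu_stable cB) 1?(mu_stable cB nk)//.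
by rewrite (leq_trans nk)// leq_maxr.
Qed.

Let limit_content_ge0 B : 0 <= m B. Proof. exact: measure_ge0. Qed.

Let limit_content0 : m set0 = 0.
Proof. by rewrite (@limit_contentE 0 (N 0)). Qed.

Let limit_content_additive : measure_function.semi_additive m.
Proof.
apply/(additive2P limit_content0) => A B [i cA] [j cB] AB.
pose k := maxn i j; have cA' : cylinder k A by exact: cylinder_le (leq_maxl _ _) cA.
have cB' : cylinder k B by exact: cylinder_le (leq_maxr _ _) cB.
rewrite !(@limit_contentE k (N k))//; last exact: cylinderU.
by rewrite measureU//; exact: (@measurable_cylinder _ k).
Qed.

HB.instance Definition _ := isContent.Build _ _ _ m
  limit_content_ge0 limit_content_additive.

Let m_le A B : is_cylinder A -> is_cylinder B -> A `<=` B -> m A <= m B.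
Proof. by move=> cA cB AB; apply: le_measure; rewrite ?inE. Qed.

Let m_leU A B C : is_cylinder A -> is_cylinder B -> is_cylinder C ->
  A `<=` B `|` C -> m A <= m B + m C.
Proof.
move=> cA cB cC ABC.
apply: (@le_trans _ _ (m (B `|` C))); first by apply: m_le => //; exact: is_cylinderU.
have cD : is_cylinder (C `\` B) by exact: (@measurableD _ (cylinder_algebra Sigma)).
have -> : B `|` C = B `|` (C `\` B).
  apply/seteqP; split=> x; last by move=> [Bx|[Cx _]]; [left|right].
  by have [Bx _|nBx [//|Cx]] := pselect (B x); [left|right].
rewrite measureU//; last by rewrite setDE setICA setICr setI0.
by apply: leeD => //; apply: m_le => //; exact: subDsetl.
Qed.

(** The first [p] codes give finitely many balls of level [n]; as [p] grows these exhaust the space,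
    so continuity from above makes the mass of the complement tend to zero. *)
Let tight k n (e : R) : (0 < e)%R ->
  exists s : seq M, mu k (~` \bigcup_(a in [set` s]) cyl_ball n a) < e%:E.
Proof.
move=> e0.
pose s p := [seq mset_rep t
  | t <- (pmap unpickle (iota 0 p) : seq {ffun n.-bseq Sigma -> nat})].
pose F p : set M := ~` \bigcup_(a in [set` s p]) cyl_ball n a.
have cF p : cylinder n (F p).
  by apply/cylinderC/cylinder_bigcup => a; exact: cylinder_ball.
have F0 : \bigcap_p F p = set0.
  apply/seteqP; split=> // a aF.
  have [t _ ta] : (\bigcup_t cyl_ball n (@mset_rep _ n t)) a by rewrite bigcup_ball.
  apply: (aF (pickle t).+1 I); exists (mset_rep t) => //=.
  apply/map_f; rewrite mem_pmap; apply/mapP; exists (pickle t).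
    by rewrite mem_iota/= add0n ltnS.
  by rewrite pickleK.
have : mu k \o F @ \oo --> mu k (\bigcap_p F p).
  apply: nonincreasing_cvg_mu.
  - apply: (@le_lt_trans _ _ 1); last exact: ltry.
    by apply: probability_le1; exact: (measurable_cylinder (cF _)).
  - by move=> i; exact: (measurable_cylinder (cF _)).
  - by rewrite F0.
  - move=> p q pq; apply/subsetPset; apply: subsetC => a [_ /mapP[t tp ->] ta].
    exists (mset_rep t) => //; apply/map_f; move: tp; rewrite !mem_pmap.
    move=> /mapP[i ip ti]; apply/mapP; exists i => //.
    by move: ip; rewrite !mem_iota !add0n => /= /leq_trans; exact.
rewrite F0 measure0 => Fcvg.
have : nbhs (0 : \bar R) [set x | x < e%:E].
  by apply: open_nbhs_nbhs; split; [exact: open_ereal_lt_ereal|rewrite /= lte_fin].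
by move=> /Fcvg[p _ /(_ p (leqnn p)) Fp]; exists (s p).
Qed.

Section DecreasingCylinders.
Variable B : nat -> set M.
Hypothesis (cB : forall p, is_cylinder (B p)).
Hypothesis (ndB : forall p q, (p <= q)%N -> B q `<=` B p).

Let is_cylinderI : setI_closed (@is_cylinder Sigma).
Proof. exact: (@measurableI _ (cylinder_algebra Sigma)). Qed.

Let is_cylinder_ball n a : is_cylinder (cyl_ball n a : set M).
Proof. by exists n; exact: cylinder_ball. Qed.

Let is_cylinder_bigcup n (s : seq M) :
  is_cylinder (\bigcup_(a in [set` s]) cyl_ball n a).
Proof. by exists n; apply: cylinder_bigcup => a; exact: cylinder_ball. Qed.

(* Since [B] decreases, this says that the mass of [B p] in [C] tends to [0]. *)
Let vanishing C := forall e : R, (0 < e)%R -> exists p, m (B p `&` C) < e%:E.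

Let vanishing_subU C D E : is_cylinder C -> is_cylinder D -> is_cylinder E ->
  E `<=` C `|` D -> vanishing C -> vanishing D -> vanishing E.
Proof.
move=> cC cD cE ECD nC nD e e0; have e20 : (0 < e / 2)%R by rewrite divr_gt0.
have [[p Cp] [q Dq]] := (nC _ e20, nD _ e20); exists (maxn p q).
rewrite (splitr e) EFinD; apply: le_lt_trans (lteD Cp Dq).
apply: m_leU; [exact: is_cylinderI..|] => x [Bx /ECD[Cx|Dx]]; [left|right].
  by split=> //; apply: ndB Bx; rewrite leq_maxl.
by split=> //; apply: ndB Bx; rewrite leq_maxr.
Qed.

Let vanishing_bigcup n (s : seq M) C : is_cylinder C ->
  (forall a, vanishing (C `&` cyl_ball n a)) ->
  vanishing (C `&` \bigcup_(a in [set` s]) cyl_ball n a).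
Proof.
move=> cC nC; elim: s => [|a s IH].
  move=> e e0; exists 0%N; rewrite (_ : [set` [::]] = set0).
    by rewrite bigcup_set0 !setI0 measure0 lte_fin.
  by apply/seteqP; split.
apply: vanishing_subU (nC a) IH; try exact: is_cylinderI.
move=> x [Cx [b /=]]; rewrite inE => /orP[/eqP ->|bs] bx; [left|right] => //.
by split=> //; exists b.
Qed.

(** Tightness leaves mass below [e / 2] outside finitely many balls, and a common stage handles
    those balls. Read contrapositively, a set that keeps its mass keeps some in one ball of level
    [n]. *)
Let vanishing_cover n C : is_cylinder C ->
  (forall a, vanishing (C `&` cyl_ball n a)) -> vanishing C.
Proof.
move=> cC nC e e0; have e20 : (0 < e / 2)%R by rewrite divr_gt0.
have [s Hs] := tight (N n) n e20.
have [p Hp] := vanishing_bigcup s cC nC e20; exists p.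
have cs : cylinder n (~` \bigcup_(a in [set` s]) cyl_ball n a).
  by apply/cylinderC/cylinder_bigcup => a; exact: cylinder_ball.
move: Hs; rewrite -(limit_contentE cs (leqnn _)) => Hs.
rewrite (splitr e) EFinD; apply: le_lt_trans (lteD Hp Hs).
apply: m_leU; [exact: is_cylinderI| |by exists n|].
  by do 2?apply: is_cylinderI.
move=> x [Bx Cx]; have [sx|nsx] := pselect ((\bigcup_(a in [set` s]) cyl_ball n a) x).
  by left.
by right.
Qed.

Let decreasing_cylinder_point : ~ vanishing setT -> \bigcap_p B p !=set0.
Proof.
move=> nT.
have nn0 C : ~ vanishing C -> forall p, B p `&` C !=set0.
  move=> nC p; apply/set0P/negP => /eqP H; apply: nC => e e0.
  by exists p; rewrite H measure0 lte_fin.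
have step (x : {na : nat * M | ~ vanishing (cyl_ball na.1 na.2)}) :
    exists y : {na : nat * M | ~ vanishing (cyl_ball na.1 na.2)},
      (sval y).1 = (sval x).1.+1 /\ agree (sval x).1 (sval x).2 (sval y).2.
  case: x => -[n a] /= na.
  (* The next ball is sought inside the current one, so that the branch is nested. *)
  have [b nb] : exists b, ~ vanishing (cyl_ball n a `&` cyl_ball n.+1 b).
    apply: contrapT => /forallNP H; apply: na; apply: (@vanishing_cover n.+1) => //.
    by move=> b; apply: contrapT; exact: H.
  (* A set that keeps its mass is nonempty; a common point [c] of the two balls makes their centres
     agree below level [n]. *)
  have [c [_ [ac bc]]] := nn0 _ nb 0%N.
  have ab : agree n a b.
    by apply: agree_trans ac _; apply/agree_sym/(agree_le (leqnSn n) bc).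
  have nb' : ~ vanishing (cyl_ball (n.+1, b).1 (n.+1, b).2).
    move=> H; apply: nb; apply: (vanishing_subU _ _ _ _ H H) => //.
    - exact: is_cylinderI.
    - by move=> x [_ bx]; left.
  by exists (exist _ (n.+1, b) nb').
have n0 : ~ vanishing (cyl_ball 0 (@sm_empty Sigma)).
  by rewrite (_ : cyl_ball 0 _ = setT)//; apply/seteqP; split.
have [f fP] := choice step.
pose x n := iter n f (exist _ (0%N, @sm_empty Sigma) n0).
have x1 n : (sval (x n)).1 = n by elim: n => //= n IH; rewrite (fP (x n)).1 IH.
pose a n := (sval (x n)).2.
have aS n : agree n (a n) (a n.+1).
  by have := (fP (x n)).2; rewrite x1.
have ale n k : (n <= k)%N -> agree n (a n) (a k).
  move=> /subnK <-; elim: (k - n)%N => // j IH.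
  by apply: agree_trans IH _; apply: agree_le (aS _); rewrite leq_addl.
(* The limit of the branch: the value at [w] is settled from level [(size w).+1] on, the first level
   that sees [w]. *)
pose b : M := fun w => a (size w).+1 w.
have ab n : agree n (a n) b.
  by move=> w wn; rewrite /b (ale (size w).+1 n)// ltnS.
exists b => p _; have [n cn] := cB p.
(* [B p] meets the ball of the very level at which it is a cylinder, so it contains that whole ball,
   and [b] with it. *)
have [c [Bc ac]] : B p `&` cyl_ball n (a n) !=set0.
  by apply: nn0; have := svalP (x n); rewrite -/(a n) x1.
by apply: cn Bc; apply: agree_trans (ab n); exact: agree_sym.
Qed.

Lemma limit_content_decreasing : \bigcap_p B p = set0 ->
  forall e : R, (0 < e)%R -> exists p, m (B p) < e%:E.
Proof.
move=> B0 e e0; have [nT|/decreasing_cylinder_point] := pselect (vanishing setT).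
  by have [p] := nT e e0; rewrite setIT; exists p.
by rewrite B0 => -[].
Qed.

End DecreasingCylinders.

(** Removing the first [p] sets from [D] leaves cylinders decreasing to the empty set. Some
    remainder has mass below [e], and finite subadditivity bounds the removed part. *)
Let limit_content_sigma_subadditive : measurable_subset_sigma_subadditive m.
Proof.
move=> D A cA cD DA; apply/lee_addgt0Pr => e e0.
pose B p : set M := D `\` \big[setU/set0]_(i < p) A i.
have cU p : is_cylinder (\big[setU/set0]_(i < p) A i).
  exact: (@bigsetU_measurable _ (cylinder_algebra Sigma)).
have cB p : is_cylinder (B p).
  by apply: (@measurableD _ (cylinder_algebra Sigma)) => //; exact: cU.
have ndB p q : (p <= q)%N -> B q `<=` B p.
  move=> pq x [Dx nAx]; split=> // Ax; apply: nAx.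
  exact: (subset_bigsetU pq).
have B0 : \bigcap_p B p = set0.
  apply/seteqP; split=> // x Bx; have [Dx _] := Bx 0%N I.
  have [i _ Ai] := DA x Dx; have [_] := Bx i.+1 I; apply.
  by rewrite big_ord_recr; right.
have [p Bp] := limit_content_decreasing cB ndB B0 e0.
have mU : m (\big[setU/set0]_(i < p) A i) <= \sum_(i < p) m (A i).
  elim: p {Bp} => [|p IH]; first by rewrite !big_ord0 measure0.
  rewrite !big_ord_recr/=; apply: le_trans (leeD2r _ IH).
  have := cU p.+1; rewrite big_ord_recr /= => cUS.
  by apply: m_leU; [exact: cUS|exact: cU|exact: cA|].
apply: (@le_trans _ _ (m (\big[setU/set0]_(i < p) A i) + m (B p))).
  apply: m_leU; [exact: cD|exact: cU|exact: cB|] => x Dx.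
  by have [Ax|nAx] := pselect ((\big[setU/set0]_(i < p) A i) x); [left|right].
apply: leeD; last exact: ltW.
apply: (le_trans mU); rewrite -(big_mkord xpredT (fun i => m (A i))).
by apply: nneseries_lim_ge => i _ _; exact: measure_ge0.
Qed.

HB.instance Definition _ := @Content_SigmaSubAdditive_isMeasure.Build _ _ _
  m limit_content_sigma_subadditive.

Lemma cylinder_limit : exists nu : probability M R,
  forall n B, cylinder n B -> nu B = mu (N n) B.
Proof.
pose E := measure_extension m.
have EE n B : cylinder n B -> E B = mu (N n) B.
  move=> cB; have mB : is_cylinder B by exists n.
  by rewrite -(limit_contentE cB (leqnn _)) /E /measure_extension measurable_mu_extE.
(* The extension lives on the sigma-algebra generated by the cylinders; the identity carries it to
   the one generated by the classes of [eq_upto]. *)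
have mid : measurable_fun
    [set: g_sigma_algebraType (@measurable _ (cylinder_algebra Sigma))]
    (id : _ -> M).
  apply: measurable_fun_cylinder => n B cB; apply: sub_sigma_algebra.
  by exists n.
have [Q QE] : exists Q : probability (g_sigma_algebraType
    (@measurable _ (cylinder_algebra Sigma))) R, Q = E :> (set _ -> \bar R).
  by apply: probability_of_measure; rewrite -(probability_setT (mu (N 0))); exact: EE.
have [P PQ] := pushforward_probability Q mid.
by exists P => n B cB; rewrite PQ /pushforward QE; exact: EE.
Qed.

End Limit.

(** * Finite products of probability measures *)

Section ProductMeasure.
Context d (T : measurableType d) (R : realType).

Lemma product_measure_seq_probability (mus : seq (probability T R)) :
  exists P : probability ((size mus).-tuple T) R,
    P = @product_measure_seq d T R mus :> (set _ -> \bar R).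
Proof.
elim: mus => [|mu mus [P PE]] /=; first by exists (dirac [tuple]).
rewrite -PE.
have mcons : measurable_fun [set: T * (size mus).-tuple T]
    (fun p : T * (size mus).-tuple T => [tuple of p.1 :: p.2]).
  exact: measurable_cons.
by have [Q QE] := pushforward_probability (mu \x P)%E mcons; exists Q.
Qed.

Lemma product_measure_swap d' (T' : measurableType d') (mu : probability T R)
    (P : probability T' R) (A : set (T * T')) : measurable A ->
  (mu \x P)%E A = (mu \x^ P)%E A.
Proof.
move=> mA; rewrite /product_measure1 /product_measure2.
by rewrite -indic_fubini_tonelli_FE// -indic_fubini_tonelli_GE// indic_fubini_tonelli.
Qed.

End ProductMeasure.

(** * One application of the right-hand side of the equations *)

Section Step.
Variables (R : realType) (Sigma : finType).
Local Notation M := (string_mset Sigma).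
Implicit Types (mu nu : probability M R).

Definition agree_prob n mu nu := forall B, cylinder n B -> mu B = nu B.

Lemma agree_prob0 mu nu : agree_prob 0 mu nu.
Proof. by move=> B /cylinder0[] ->; rewrite ?measure0 ?probability_setT. Qed.

Lemma mix_measure_probability (S : finType) (r : fdist R S)
    (mu : S -> probability M R) :
  exists P : probability M R, P = mix_measure r mu :> (set _ -> \bar R).
Proof.
(* [msum] is indexed by natural numbers, so the states are enumerated and indices past [#|S|]
   receive the zero measure. *)
pose g (k : nat) : {measure set M -> \bar R} :=
  if insub k is Some i then
    mscale (NngNum (fdist_ge0 r (enum_val i))) (mu (enum_val (i : 'I_#|S|)))
  else mzero.
have mixE : msum g #|S| = mix_measure r mu.
  apply/funext => B; rewrite /msum /mix_measure.
  rewrite [RHS](reindex_onto (fun i : 'I_#|S| => enum_val i) enum_rank)/=; last first.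
    by move=> i _; rewrite enum_rankK.
  rewrite [RHS](eq_bigl xpredT); last by move=> i; rewrite enum_valK eqxx.
  apply: eq_bigr => i _; rewrite /g insubT//= => ik.
  by rewrite /mscale/= (_ : Sub _ _ = i)//; exact: val_inj.
have [|P PE] := @probability_of_measure _ M R (msum g #|S|).
  transitivity (mix_measure r mu setT); [by rewrite -mixE|rewrite /mix_measure].
  under eq_bigr do rewrite probability_setT mule1.
  by rewrite sumEFin fdist_sum1.
by exists P; rewrite PE.
Qed.

(* The other factors are exchanged under the integral over the first one, and
   then, by Fubini, the first factor under the integral over the others. *)
Lemma product_agree_cylinder n (I : eqType) (l : seq I) (f g : I -> probability M R)
    (C : set (seq M)) : cylinder_seq n C ->
  {in l, forall t, agree_prob n (f t) (g t)} ->
  product_measure_seq [set s : (size (map f l)).-tuple M | C s] =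
  product_measure_seq [set s : (size (map g l)).-tuple M | C s].
Proof.
elim: l C => [|t l IH] C cC fg; first by rewrite /= !diracE.
rewrite /= /pushforward.
have [P PE] := product_measure_seq_probability (map f l).
have [Q QE] := product_measure_seq_probability (map g l).
rewrite -PE -QE.
have mD k : measurable [set p : M * k.-tuple M | C (p.1 :: p.2)].
  have mcons : measurable_fun [set: M * k.-tuple M]
      (fun p : M * k.-tuple M => [tuple of p.1 :: p.2]).
    exact: measurable_cons.
  rewrite -[X in measurable X]setTI.
  apply: (mcons measurableT [set s : k.+1.-tuple M | C s]).
  by apply: (@measurable_cylinder_seq _ n).
have PQ a : P [set s : _.-tuple M | C (a :: s)] = Q [set s : _.-tuple M | C (a :: s)].
  rewrite PE QE; apply: (IH [set s | C (a :: s)]); first exact: cylinder_seq_cons.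
  by move=> u ul; apply: fg; rewrite inE ul orbT.
pose D k : set (M * k.-tuple M) :=
  [set p : M * k.-tuple M | C (p.1 :: p.2)].
have xD k a : xsection (D k) a = [set s : k.-tuple M | C (a :: s)].
  by apply/seteqP; split=> s; rewrite /xsection/= inE.
have yD k (s : k.-tuple M) : ysection (D k) s = [set a | C (a :: s)].
  by apply/seteqP; split=> a; rewrite /ysection/= inE.
transitivity ((f t \x Q)%E (D _)).
  by apply: eq_integral => a _ /=; rewrite !xD.
transitivity ((g t \x Q)%E (D _)); last by [].
rewrite !product_measure_swap; [|exact: mD|exact: mD].
apply: eq_integral => s _ /=; rewrite yD; apply: fg; first exact: mem_head.
exact: cylinder_seq_head.
Qed.

End Step.

Section StepAutomaton.
Variables (R : realType) (Sigma : finType) (A : automaton R Sigma).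
Local Notation M := (string_mset Sigma).

Lemma sem_rhs_probability (sem : A -> probability M R) s :
  exists P : probability M R, P = sem_rhs sem s :> (set _ -> \bar R).
Proof.
rewrite /sem_rhs; case: (lab s) (delta s) => [m|r|_|_|a t].
- rewrite /par_measure.
  have [P <-] := product_measure_seq_probability [seq sem t | t <- enum_mset m].
  exact (pushforward_probability P (@measurable_sm_sum Sigma _)).
- exact: mix_measure_probability.
- by exists (dirac (@sm_eps Sigma)).
- by exists (dirac (@sm_empty Sigma)).
- exact (pushforward_probability (sem t) (@measurable_sm_act Sigma a)).
Qed.

(** The boolean [is_letter s] is read as a number: prefixing a letter lengthens every string by one,
    which is the level gained there. *)
Lemma sem_rhs_agree n (sem sem' : A -> probability M R) s :
  (forall t, edge s t -> agree_prob n (sem t) (sem' t)) ->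
  forall B, cylinder (n + is_letter s) B -> sem_rhs sem s B = sem_rhs sem' s B.
Proof.
rewrite /edge /is_letter /sem_rhs.
case: (lab s) (delta s) => [m|r|_|_|a u]/= H B; rewrite ?addn0 ?addn1 => cB //.
- rewrite /par_measure /pushforward.
  have E k : @sm_sum Sigma k @^-1` B =
      [set s : k.-tuple M | (@seq_sum Sigma @^-1` B) s].
    by apply/seteqP; split=> z /=; rewrite sm_sumE.
  rewrite !E; apply: (@product_agree_cylinder _ _ n); first exact: cylinder_seq_sum.
  by move=> t tm; apply: H.
(* Targets of weight zero are not successors, so nothing is known about them, but their terms
   vanish. *)
- apply: eq_bigr => t _; have := fdist_ge0 r t; rewrite le_eqVlt => /predU1P[<-|rt].
    by rewrite !mul0e.
  by rewrite (H t rt).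
- by apply: (H u); [rewrite eqxx|exact: cylinder_act].
Qed.

End StepAutomaton.

(** Infinite descent: every counterexample has a successor that is one too, and among [#|S|.+1]
    iterates two coincide, which closes a cycle. *)
Lemma acyclic_ind (S : finType) (e : rel S) (P : S -> Prop) :
  (forall c, cycle e c -> c = [::]) ->
  (forall s, (forall t, e s t -> P t) -> P s) -> forall s, P s.
Proof.
move=> acyclic step s; apply: contrapT => nPs.
have next (x : {s | ~ P s}) : exists y : {s | ~ P s}, e (sval x) (sval y).
  case: x => x /= nPx; apply: contrapT => /forallNP H; apply: nPx; apply: step => t xt.
  by apply: contrapT => nPt; exact: (H (exist _ t nPt)).
have [f fe] := choice next.
pose x i := sval (iter i f (exist _ s nPs)).
have xe i : e (x i) (x i.+1) by exact: fe.
have xpath i n : path e (x i) [seq x j | j <- iota i.+1 n].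
  by elim: n i => //= n IH i; rewrite xe IH.
have [i [j [ij xij]]] : exists i j : nat, (i < j)%N /\ x i = x j.
  have /injectivePn[i [j ij xij]] : ~~ injectiveb (fun i : 'I_#|S|.+1 => x i).
    by apply/negP => /injectiveP /leq_card; rewrite card_ord ltnn.
  by have [ij'|ij'|/val_inj/eqP] := ltngtP i j;
    [exists i, j|exists j, i|rewrite (negbTE ij)].
suff /acyclic : cycle e (x i :: [seq x k | k <- iota i.+1 (j - i.+1)]) by [].
rewrite /= (_ : rcons _ _ = [seq x k | k <- iota i.+1 (j - i.+1).+1]) ?xpath//.
by rewrite -[(j - i.+1).+1]addn1 iotaD map_cat cats1 subnKC// xij.
Qed.

(** * Uniqueness and existence of the semantics *)

Section Semantics.
Variables (R : realType) (Sigma : finType) (A : automaton R Sigma).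
Hypothesis prodA : productive A.
Local Notation M := (string_mset Sigma).
Implicit Types sem : A -> probability M R.

(** Keep only the edges that leave non-letter states. A cycle of these would contain a letter state
    by productivity, yet no kept edge leaves that state. *)
Lemma productive_ind (P : A -> Prop) :
  (forall s, (~~ is_letter s -> forall t, edge s t -> P t) -> P s) -> forall s, P s.
Proof.
move=> step; apply: (@acyclic_ind A [rel s t | ~~ is_letter s && edge s t]).
  move=> c cc; apply/eqP; apply: contraTT (cc) => c0.
  have ce : cycle (@edge R Sigma A) c by apply: sub_cycle cc => s t /andP[].
  have /hasP[s sc ls] := prodA c0 ce; apply/negP => /next_cycle/(_ sc).
  by rewrite /= ls.
by move=> s H; apply: step => ls t st; apply: H; rewrite /= ls.
Qed.

(** Induction on the level, then along non-letter edges: a letter state lifts agreement from level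
    [n] to [n.+1], and any other state inherits level [n.+1] from its successors. *)
Lemma is_semantics_agree n sem sem' : is_semantics sem -> is_semantics sem' ->
  forall s, agree_prob n (sem s) (sem' s).
Proof.
move=> hs hs'; elim: n => [|n IHn]; first by move=> s; exact: agree_prob0.
apply: productive_ind => s IHs B cB.
rewrite hs ?hs'; [|exact: measurable_cylinder cB..].
have [ls|ls] := boolP (is_letter s).
  by apply: (@sem_rhs_agree _ _ _ n) => //; rewrite ls addn1.
by apply: (@sem_rhs_agree _ _ _ n.+1) => [t|]; [exact: IHs|rewrite (negbTE ls) addn0].
Qed.

(** The cylinders are stable under intersection and generate the sigma-algebra, so they determine a
    finite measure. *)
Lemma agree_prob_eq (mu nu : probability M R) : (forall n, agree_prob n mu nu) ->
  forall B, measurable B -> mu B = nu B.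
Proof.
move=> H B mB; apply: (@measure_unique _ R M (@is_cylinder Sigma) (fun=> setT)) => //.
- apply/seteqP; split.
    apply: sub_smallest2r => [|_ [a [n ->]]]; first exact: smallest_sigma_algebra.
    by exists n.+1; exact: cylinder_ball.
  apply: smallest_sub; first exact: sigma_algebra_measurable.
  by move=> C [n cC]; exact: measurable_cylinder cC.
- by move=> C D; exact: (@measurableI _ (cylinder_algebra Sigma)).
- by exists 0%N.
- by rewrite bigcup_const.
- by move=> C [n cC]; exact: H cC.
- move=> _; apply: (@le_lt_trans _ _ 1%E); last exact: ltry.
  exact: probability_le1.
Qed.

(** Finitely many indices allow one threshold, the maximum. It is needed for the successors of a
    state and for all states at once. *)
Lemma stable_uniform (I : finType) (Q : I -> Prop) n
    (mu : nat -> I -> probability M R) :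
  (forall i, Q i -> exists K,
    forall k, (K <= k)%N -> agree_prob n (mu k i) (mu K i)) ->
  exists K, forall i, Q i ->
    forall k, (K <= k)%N -> agree_prob n (mu k i) (mu K i).
Proof.
move=> H; have {}H i : exists K, Q i ->
    forall k, (K <= k)%N -> agree_prob n (mu k i) (mu K i).
  have [/H[K HK]|nQ] := pselect (Q i); first by exists K.
  by exists 0%N.
have [K HK] := choice H; exists (\max_i K i)%N => i Qi k Kk B cB.
have Ki : (K i <= \max_i K i)%N by exact: leq_bigmax.
by rewrite (HK i Qi k (leq_trans Ki Kk) B cB) (HK i Qi _ Ki B cB).
Qed.

Lemma semantics_exists : exists sem, is_semantics sem.
Proof.
pose Phi sem s := sval (cid (sem_rhs_probability sem s)).
have PhiE sem s : Phi sem s = sem_rhs sem s :> (set _ -> \bar R).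
  exact: (svalP (cid (sem_rhs_probability sem s))).
pose it k : A -> probability M R := iter k Phi (fun=> dirac (@sm_empty Sigma)).
have stable n : exists N, forall s, True ->
    forall k, (N <= k)%N -> agree_prob n (it k s) (it N s).
  elim: n => [|n [N HN]]; first by exists 0%N => s _ k _; exact: agree_prob0.
  apply: (@stable_uniform _ (fun=> True)) => s _; move: s.
  apply: productive_ind => s IHs.
  have [ls|ls] := boolP (is_letter s).
    exists N.+1 => -[//|k] Nk B cB; rewrite /= !PhiE.
    by apply: (@sem_rhs_agree _ _ _ n) => [t _|]; [exact: HN|rewrite ls addn1].
  have [K HK] := stable_uniform (IHs ls).
  exists K.+1 => -[//|k] Kk B cB; rewrite /= !PhiE.
  by apply: (@sem_rhs_agree _ _ _ n.+1) => [t st|]; [exact: HK|rewrite (negbTE ls) addn0].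
have [N HN] := choice stable.
have lim s : exists nu : probability M R,
    forall n B, cylinder n B -> nu B = it (N n) s B.
  apply: (@cylinder_limit _ _ (fun k => it k s)) => n k B cB Nk.
  exact: (HN n s I k Nk B cB).
have [sem semE] := choice lim; exists sem => s B mB.
have [P PE] := sem_rhs_probability sem s; rewrite -PE.
apply: agree_prob_eq mB => n C cC.
(* At level [n] the limit agrees with iterate [(N n).+1], which is the right-hand side at iterate
   [N n]; that iterate in turn agrees with the limit at level [n]. *)
rewrite PE (semE s n C cC) -(HN n s I (N n).+1 (leqnSn _) C cC) /= PhiE.
apply: (@sem_rhs_agree _ _ _ n) => [t _ D cD|]; first by rewrite (semE t n D cD).
by apply: cylinder_le cC; rewrite leq_addr.
Qed.

End Semantics.

Theorem theorem5p6 (R : realType) (Sigma : finType) (A : automaton R Sigma)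
    (prodA : productive A) :
  exists sem : A -> probability (string_mset Sigma) R,
    is_semantics sem /\
    forall sem' : A -> probability (string_mset Sigma) R,
      is_semantics sem' ->
      forall (s : A) (B : set (string_mset Sigma)),
        measurable B -> sem' s B = sem s B.
Proof.
have [sem hsem] := semantics_exists prodA; exists sem; split=> // sem' hsem' s B.
by apply: agree_prob_eq => n; exact: is_semantics_agree.
Qed.
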